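(* Let $r,s$ be fixed nonnegative integers with $r\ge 2s+1$. There exists a constant $N$ such that for all $n>N$ the graph $G(n,r,s)$ is hamiltonian.
   Context: For integers $n,r,s$, the Johnson graph $G(n,r,s)$ has as vertices all vectors $v\in\{0,1\}^n$ with exactly $r$ ones; two vertices are joined by an edge if and only if their inner product equals $s$. A graph is hamiltonian if it contains a cycle passing through each vertex exactly once. *)

(* Defs.v *)
From HB Require Import structures.
From mathcomp Require Import all_boot.

Set Implicit Arguments.
Unset Strict Implicit.
Unset Printing Implicit Defensive.

(* Vectors of {0,1}^n are boolean functions on 'I_n; in the sums below their
   entries are read as natural numbers through the coercion nat_of_bool. *)
Definition johnson_vertex (n r : nat) : finType :=
  {v : {ffun 'I_n -> bool} | \sum_(i < n) v i == r}.

Definition inner_prod (n : nat) (v w : {ffun 'I_n -> bool}) : nat :=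
  \sum_(i < n) v i * w i.

(* The condition v != w keeps the graph loopless; it only matters if r = s. *)
Definition johnson_edge (n r s : nat) : rel (johnson_vertex n r) :=
  fun v w => (v != w) && (inner_prod (val v) (val w) == s).

(* The size condition excludes the degenerate closed walks x and x, y, which
   ucycle accepts but which are not cycles of a simple graph. *)
Definition hamiltonian (T : finType) (e : rel T) : Prop :=
  exists c : seq T, [/\ 2 < size c, ucycle e c & forall x : T, x \in c].

(* Main.v *)
Require Import Defs.
From mathcomp Require Import all_boot.
From mathcomp Require Import zify.

(* Attach to every vertex an s-subset of its support, its core.  Two vertices
   with the same core S are adjacent unless they share a point outside S, which
   is rare: if all cores occur for about n^(r-s) vertices, each class of
   vertices with a given core is an almost complete graph, hence is
   Hamilton-connected, and a Hamiltonian cycle visits the classes one after the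
   other through edges between consecutive classes.  To get large classes, cut
   {0, ..., n-1} into 2s+1 residue classes (blocks): the core is obtained by
   removing the r-s points of a single block.  A core S misses some block, and
   any r-s points of that block complete S to a vertex with core S; two cores
   miss a common block, which provides an edge between their classes. *)

Set Implicit Arguments.
Unset Strict Implicit.
Unset Printing Implicit Defensive.

(** * Hamilton-connectedness of almost complete graphs *)

Section HamiltonConnected.
Variables (T : finType) (e : rel T).
Hypothesis e_sym : symmetric e.

(* The term [~~ e w u] is a credit that makes the induction go through: two
   consecutive neighbours of [w] exist as soon as the path has more than
   twice as many vertices as [w] has non-neighbours on it. *)
Lemma path_insert (w u : T) (p : seq T) :
    path e u p ->
    2 * count (predC (e w)) (u :: p) + 1 < size (u :: p) + ~~ e w u ->
  exists p', [/\ path e u p', last u p' = last u p & perm_eq p' (w :: p)].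
Proof.
elim: p u => [|y p IHp] u /=; first by case: (e w u).
case/andP=> euy ep lt_sz.
case: (boolP (e w u && e w y)) => [/andP[ewu ewy] | nbr].
  by exists [:: w, y & p]; rewrite /= e_sym ewu ewy ep.
have [|p' [ep' lp' pp']] := IHp y ep.
  by move: lt_sz nbr; rewrite /=; case: (e w u); case: (e w y) => //=; lia.
exists (y :: p'); rewrite /= euy ep' lp'; split=> //.
by rewrite -[w :: _](cat1s w) perm_sym (perm_catCA [:: w] [:: y]) /= perm_cons
  perm_sym.
Qed.

Variables (H : {set T}) (D : nat).
Hypothesis H_deg :
  forall x, x \in H -> #|[set y in H | ~~ e x y]| <= D.

(** The vertices of [ws] are inserted one at a time, each between two consecutive vertices, so both
    ends stay. Each has at most [D] non-neighbours on the path, and insertions only lengthen [p], so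
    [2 * D < size p] persists. *)
Lemma path_insert_all (u : T) (p ws : seq T) :
    path e u p -> uniq (ws ++ u :: p) -> {subset ws ++ u :: p <= H} ->
    2 * D < size p ->
  exists p', [/\ path e u p', last u p' = last u p & perm_eq p' (ws ++ p)].
Proof.
elim: ws p => [|w ws IHws] p ep; first by exists p.
move=> /= /andP[w_new uniq_p] sHp lt_p.
have sHp' : {subset ws ++ u :: p <= H}.
  by move=> x xp; apply: sHp; rewrite inE xp orbT.
have wH : w \in H by apply: sHp; rewrite inE eqxx.
have count_le : count (predC (e w)) (u :: p) <= D.
  apply: leq_trans (H_deg wH); rewrite -size_filter.
  have uniq_f : uniq (filter (predC (e w)) (u :: p)).
    by apply: filter_uniq; move: uniq_p; rewrite cat_uniq => /and3P[].
  rewrite -(card_uniqP uniq_f); apply/subset_leq_card/subsetP=> x.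
  rewrite mem_filter inE => /andP[/= -> xp]; rewrite andbT.
  by apply: sHp'; rewrite mem_cat xp orbT.
have [|p1 [ep1 lp1 pp1]] := @path_insert w u p ep.
  by move: count_le => /=; lia.
have eq_up : perm_eq (ws ++ u :: p1) (w :: ws ++ u :: p).
  rewrite -[w :: _]/([:: w] ++ (ws ++ (u :: p))) perm_sym perm_catCA.
  rewrite perm_cat2l /=.
  rewrite -[[:: w, u & p]]/([:: w] ++ [:: u] ++ p) perm_catCA /= perm_cons.
  by rewrite perm_sym.
have [||| p2 [ep2 lp2 pp2]] := IHws p1 ep1.
- by rewrite (perm_uniq eq_up) /= w_new.
- by move=> x; rewrite (perm_mem eq_up); apply: sHp.
- by rewrite (perm_size pp1) /=; lia.
exists p2; split=> //; first by rewrite lp2.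
apply: (perm_trans pp2); rewrite -[w :: _]/([:: w] ++ (ws ++ p)) perm_sym.
by rewrite perm_catCA perm_cat2l perm_sym.
Qed.

Lemma common_neighbor (x y : T) (s : seq T) :
    x \in H -> y \in H -> 2 * D + size s < #|H| ->
  exists z, [/\ z \in H, e x z, e y z & z \notin s].
Proof.
move=> xH yH lt_H.
pose Z := [set z in H | ~~ e x z] :|: [set z in H | ~~ e y z]
          :|: [set z in s].
have : ~~ (H \subset Z).
  apply: contraL lt_H => /subset_leq_card sHZ; rewrite -leqNgt.
  apply: leq_trans sHZ _; apply: leq_trans (leq_card_setU _ _) _.
  apply: leq_add; last by rewrite cardsE card_size.
  apply: leq_trans (leq_card_setU _ _) _.
  by rewrite mulSn mul1n leq_add ?H_deg.
case/subsetPn=> z zH; rewrite !inE zH /= !negb_or !negbK.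
by case/andP=> /andP[exz eyz] zs; exists z.
Qed.

(** Greedy growth; [v] is kept off the path because it is to become the other end. *)
Lemma path_grow (u v : T) (k : nat) :
    u \in H -> v \in H -> u != v -> 2 * D + k + 1 < #|H| ->
  exists p, [/\ path e u p, uniq (v :: u :: p),
                {subset u :: p <= H} & size p = k].
Proof.
move=> uH vH uv; elim: k => [|k IHk] lt_H.
  exists [::]; split=> //=; first by rewrite inE eq_sym uv.
  by move=> x; rewrite inE => /eqP->.
have [|p [ep Up sHp sz_p]] := IHk; first by lia.
have lH : last u p \in H by apply: sHp; apply: mem_last.
(* Taking the end of the path for both vertices gives a fresh neighbour of that end. *)
have [|z [zH lz _ z_new]] := @common_neighbor _ _ (v :: u :: p) lH lH.
  by rewrite /= sz_p; lia.
exists (rcons p z); rewrite rcons_path ep lz size_rcons sz_p; split=> //.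
  by rewrite -2!rcons_cons rcons_uniq z_new.
by move=> x; rewrite -rcons_cons mem_rcons inE => /predU1P[->|/sHp].
Qed.

(** A path with [2 * D] edges is grown from [u] and joined to [v] through a common neighbour; the
    rest of [H] is then inserted. The joining vertex must avoid at most [2 * D] non-neighbours of
    the two ends and [2 * D + 2] vertices already reserved, whence [4 * D + 2]. *)
Lemma hamilton_connected (u v : T) :
    4 * D + 2 < #|H| -> u \in H -> v \in H -> u != v ->
  exists p, [/\ path e u p, last u p = v, uniq (u :: p) & u :: p =i H].
Proof.
move=> lt_H uH vH uv.
have [|p [ep Up sHp sz_p]] := @path_grow u v (2 * D) uH vH uv; first by lia.
have lH : last u p \in H by apply: sHp; apply: mem_last.
have [|z [zH lz vz z_new]] := @common_neighbor _ _ (v :: u :: p) lH vH.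
  by rewrite /= sz_p; lia.
pose p0 := rcons (rcons p z) v.
have ep0 : path e u p0.
  by rewrite !rcons_path ep lz last_rcons e_sym vz.
have Up0 : uniq (u :: p0).
  rewrite -2!rcons_cons !rcons_uniq mem_rcons inE negb_or.
  case/andP: Up => v_new Up.
  move: z_new; rewrite inE negb_or => /andP[zv z_new].
  by rewrite eq_sym zv v_new z_new.
have sHp0 : {subset u :: p0 <= H}.
  move=> x; rewrite -2!rcons_cons !(mem_rcons, inE).
  by case/or3P=> [/eqP->|/eqP->|xp] //; apply: sHp.
pose ws := [seq x <- enum H | x \notin u :: p0].
have [|||p1 [ep1 lp1 pp1]] := @path_insert_all u p0 ws ep0.
- rewrite cat_uniq Up0 filter_uniq ?enum_uniq // andbT.
  by apply/hasPn=> x xp; rewrite mem_filter xp.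
- move=> x; rewrite mem_cat mem_filter mem_enum.
  by case/orP=> [/andP[]|/sHp0].
- by rewrite !size_rcons sz_p; lia.
have eq_up : perm_eq (u :: p1) (ws ++ u :: p0).
  by rewrite perm_sym -(cat1s u p0) perm_catCA perm_cons perm_sym.
exists p1; split=> //; first by rewrite lp1 last_rcons.
  rewrite (perm_uniq eq_up) cat_uniq Up0 filter_uniq ?enum_uniq // andbT.
  by apply/hasPn=> x xp; rewrite mem_filter xp.
move=> x; rewrite (perm_mem eq_up) mem_cat mem_filter mem_enum.
by case: (boolP (x \in _ :: _)) => [/sHp0->|]; rewrite ?orbT ?orbF.
Qed.

End HamiltonConnected.

(** * Joining Hamiltonian paths of the fibres into a cycle *)

Section Gluing.
Variables (T : finType) (I : eqType) (e : rel T) (f : T -> I) (D : nat).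
Hypothesis e_sym : symmetric e.
Hypothesis e_irr : irreflexive e.
Hypothesis fiber_deg :
  forall x, #|[set y | (f y == f x) && ~~ e x y]| <= D.
Hypothesis fiber_large : forall x, 4 * D + 2 < #|[set y | f y == f x]|.
Hypothesis fiber_edge : forall x y,
  exists a b, [/\ f a = f x, f b = f y, a != x, b != y & e a b].

Lemma hamilton_path_fiber (u v : T) :
    f u = f v -> u != v ->
  exists p, [/\ path e u p, last u p = v, uniq (u :: p)
              & forall x, (x \in u :: p) = (f x == f u)].
Proof.
move=> fuv uv.
have [||||p [ep lp Up memp]] :=
  @hamilton_connected T e e_sym [set y | f y == f u] D _ u v _ _ _ uv.
- move=> x; rewrite inE => /eqP<-; apply: leq_trans (fiber_deg x).
  by apply/subset_leq_card/subsetP=> y; rewrite !inE.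
- exact: fiber_large.
- by rewrite inE.
- by rewrite inE fuv.
by exists p; split=> // x; rewrite memp inE.
Qed.

(** Each fibre must be entered and left at different vertices; the inequalities in [fiber_edge]
    serve to ensure this. *)
Lemma hamilton_path_fibers (l : seq I) (u v : T) :
    {subset l <= codom f} -> uniq (f u :: l) -> f v = last (f u) l -> u != v ->
  exists p, [/\ path e u p, last u p = v, uniq (u :: p)
              & forall x, (x \in u :: p) = (f x \in f u :: l)].
Proof.
elim: l u => [|j l IHl] u sl Ul fv uv.
  have [p [ep lp Up memp]] := hamilton_path_fiber (esym fv) uv.
  by exists p; split=> // x; rewrite memp inE.
have /codomP[y jy] : j \in codom f by apply: sl; rewrite inE eqxx.
have sl' : {subset l <= codom f} by move=> i il; apply: sl; rewrite inE il orbT.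
(* [z] is what the entry point [b] has to avoid: the target [v] if it lies in the next fibre, any
   vertex of that fibre otherwise. *)
have [z [fz zv]] : exists z, f z = j /\ (f v = j -> z = v).
  case: (eqVneq (f v) j) => [|ne]; first by exists v.
  by exists y; split=> // eq_vj; rewrite eq_vj eqxx in ne.
have [a [b [fa fb au bz eab]]] := fiber_edge u z.
have bv : b != v.
  by apply: contra_neq bz => bv; rewrite bv zv // -fz -fb bv.
have [p1 [ep1 lp1 Up1 memp1]] : exists p, [/\ path e u p, last u p = a,
    uniq (u :: p) & forall x, (x \in u :: p) = (f x == f u)].
  by apply: hamilton_path_fiber; rewrite // eq_sym.
have fbj : f b = j by rewrite fb.
have [||p2 [ep2 lp2 Up2 memp2]] := IHl b sl' _ _ bv.
- by rewrite fbj; case/andP: Ul.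
- by rewrite fbj fv.
exists (p1 ++ b :: p2); split.
- by rewrite cat_path /= ep1 lp1 eab.
- by rewrite last_cat.
- rewrite -cat_cons cat_uniq Up1 Up2 andbT; apply/hasPn=> x.
  rewrite memp2 fbj memp1 => xl; apply: contraL Ul => /eqP<-.
  by rewrite /= xl.
by move=> x; rewrite -cat_cons mem_cat memp1 memp2 fbj [RHS]inE.
Qed.

Lemma hamiltonian_fibers : 0 < #|T| -> hamiltonian e.
Proof.
case/card_gt0P=> x0 _.
pose l := undup [seq f x | x <- enum T & f x != f x0].
have sl : {subset l <= codom f}.
  by move=> i; rewrite mem_undup => /mapP[x _ ->]; apply: codom_f.
have Ul : uniq (f x0 :: l).
  rewrite /= undup_uniq andbT mem_undup; apply/mapP=> -[x].
  by rewrite mem_filter => /andP[/eqP ne _] eq0; apply: ne.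
have /codomP[y fy] : last (f x0) l \in codom f.
  have := mem_last (f x0) l; rewrite inE => /predU1P[->|/sl //].
  exact: codom_f.
(* The closing edge, from the last fibre to the first, is chosen beforehand and prescribes the ends
   of the Hamiltonian path. If there is only one fibre, this edge lies inside it. *)
have [v [u [fv fu _ _ evu]]] := fiber_edge y x0.
have uv : u != v by apply: contraTneq evu => ->; rewrite e_irr.
have [||p [ep lp Up memp]] := @hamilton_path_fibers l u v sl _ _ uv.
- by rewrite fu.
- by rewrite fu fy fv.
have in_p x : x \in u :: p.
  rewrite memp fu inE; case: eqVneq => //= ne.
  by rewrite mem_undup; apply/mapP; exists x; rewrite // mem_filter ne mem_enum.
exists (u :: p); split=> //.
  rewrite -(card_uniqP Up).
  have := fiber_large u; set F := [set y | _] => lt_F.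
  apply: leq_trans (_ : #|F| <= _); first by lia.
  by apply/subset_leq_card/subsetP=> x _.
by rewrite /ucycle Up andbT /= rcons_path ep lp.
Qed.

End Gluing.

(** * Growth of binomial coefficients *)

Lemma leq_expn2r (m n k : nat) : m <= n -> m ^ k <= n ^ k.
Proof. by case: k => // k le_mn; rewrite leq_exp2r. Qed.

Lemma ffact_leq_expn (n k : nat) : n ^_ k <= n ^ k.
Proof.
elim: k => [|k IHk]; first by rewrite ffactn0.
by rewrite ffactnSr expnSr leq_mul ?leq_subr.
Qed.

Lemma expn_leq_ffact (n k : nat) : (n - k) ^ k <= n ^_ k.
Proof.
elim: k => [|k IHk]; first by rewrite ffactn0.
rewrite ffactnSr expnSr leq_mul //; last by lia.
by apply: leq_trans IHk; rewrite leq_expn2r ?leq_sub2l.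
Qed.

Lemma bin_leq_expn (n k : nat) : 'C(n, k) <= n ^ k.
Proof.
apply: leq_trans (ffact_leq_expn n k); rewrite -bin_ffact.
by rewrite leq_pmulr ?fact_gt0.
Qed.

(** For fixed [m] and [q], the left side grows like [n ^ q] and the right side like [n ^ q.+1]. *)
Lemma bin_block_dominates (m q : nat) : 0 < m ->
  exists N, forall n, N < n ->
    4 * (q.+1 * 'C(n, q)) + 2 < 'C(n %/ m, q.+1).
Proof.
move=> m0.
(* With [L = n %/ m], [c] collects the factor [(4 * m) ^ q] from [n <= 4 * m * (L - q.+1)], the
   constants on the left, and the factorial cleared from the right. The choice of [N] makes
   [L - q.+1] exceed [c]. *)
pose c := (4 * q.+1 + 2) * (4 * m) ^ q * q.+1`!.
exists (m * (c + 2 * q.+1 + 2)) => n lt_n.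
have le_L : c + 2 * q.+1 + 2 <= n %/ m by rewrite leq_divRL // mulnC ltnW.
set L := n %/ m in le_L *.
have le_n : n <= 4 * m * (L - q.+1).
  have : n < L.+1 * m by rewrite -ltn_divLR.
  have : L.+1 <= 4 * (L - q.+1) by lia.
  by move: (L - _) (L.+1) => x y; nia.
rewrite -(ltn_pmul2r (fact_gt0 q.+1)) bin_ffact.
apply: leq_trans (expn_leq_ffact L q.+1).
have n0 : 0 < n by lia.
have le1 : 4 * (q.+1 * 'C(n, q)) + 2 <= (4 * q.+1 + 2) * n ^ q.
  have := bin_leq_expn n q; have : 0 < n ^ q by rewrite expn_gt0 n0.
  by move: (n ^ q) ('C(_, _)) => x y; nia.
have le2 : n ^ q <= (4 * m) ^ q * (L - q.+1) ^ q.
  by rewrite -expnMn leq_expn2r.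
have x0 : 0 < (L - q.+1) ^ q by rewrite expn_gt0; apply/orP; left; lia.
rewrite expnS; apply: leq_trans (_ : c.+1 * (L - q.+1) ^ q <= _); last first.
  by rewrite leq_mul2r; apply/orP; right; lia.
rewrite mulSn; apply: leq_trans (_ : 1 + c * (L - q.+1) ^ q <= _); last first.
  by rewrite leq_add2r.
rewrite add1n ltnS /c mulnAC leq_mul2r; apply/orP; right.
apply: leq_trans le1 _; rewrite -mulnA leq_mul2l; apply/orP; right.
exact: le2.
Qed.

Lemma subset_of_card (T : finType) (A : {set T}) (k : nat) :
  k <= #|A| -> exists2 B : {set T}, B \subset A & #|B| = k.
Proof.
move=> le_k; have : 0 < #|[set B : {set T} | B \subset A & #|B| == k]|.
  by rewrite cards_draws bin_gt0.
by case/card_gt0P=> B; rewrite inE => /andP[sBA /eqP eB]; exists B.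
Qed.

(** * Vertices as [r]-subsets *)

Section Support.
Variables (n r : nat).
Implicit Types v w : johnson_vertex n r.

Definition supp v : {set 'I_n} := [set i | val v i].

Lemma card_supp v : #|supp v| = r.
Proof.
rewrite -(eqP (valP v)) -sum1_card big_mkcond; apply: eq_bigr => i _.
by rewrite inE; case: (val v i).
Qed.

Lemma supp_inj : injective supp.
Proof.
move=> v w /setP eq_vw; apply/val_inj/ffunP=> i.
by have := eq_vw i; rewrite !inE.
Qed.

Lemma supp_surj (A : {set 'I_n}) : #|A| = r -> exists v, supp v = A.
Proof.
move=> cA; pose v := [ffun i => i \in A].
have vP : \sum_(i < n) v i == r.
  rewrite -cA -sum1_card [X in _ == X]big_mkcond; apply/eqP/eq_bigr => i _.
  by rewrite ffunE; case: (i \in A).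
by exists (exist _ v vP); apply/setP=> i; rewrite inE ffunE.
Qed.

Lemma inner_prod_supp v w : inner_prod (val v) (val w) = #|supp v :&: supp w|.
Proof.
rewrite -sum1_card big_mkcond; apply: eq_bigr => i _.
by rewrite !inE; case: (val v i); case: (val w i).
Qed.

Lemma johnson_edge_sym s : symmetric (@johnson_edge n r s).
Proof.
by move=> v w; rewrite /johnson_edge eq_sym !inner_prod_supp setIC.
Qed.

Lemma johnson_edge_irr s : irreflexive (@johnson_edge n r s).
Proof. by move=> v; rewrite /johnson_edge eqxx. Qed.

End Support.

(** * Blocks, cores, and the classes of vertices with a common core *)

Section Blocks.
Variables (n r s : nat).
Hypothesis hrs : 2 * s + 1 <= r.
Implicit Types v w : johnson_vertex n r.
Implicit Types S Y : {set 'I_n}.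

Definition block (k : 'I_(2 * s).+1) : {set 'I_n} :=
  [set i : 'I_n | i %% (2 * s).+1 == k].

Lemma card_block k : n %/ (2 * s).+1 <= #|block k|.
Proof.
set m := (2 * s).+1; set L := n %/ m.
have lt_n (j : 'I_L) : j * m + k < n.
  have lek : k < m := ltn_ord k; have lej := ltn_ord j.
  apply: leq_trans (leq_divM n m); apply: leq_trans (_ : j.+1 * m <= _).
    by rewrite (mulSn j); lia.
  by rewrite leq_mul2r lej orbT.
rewrite -[L]card_ord -(card_imset (f := fun j => Ordinal (lt_n j))).
  apply/subset_leq_card/subsetP=> _ /imsetP[j _ ->].
  by rewrite inE /= modnMDl modn_small.
move=> i j /(congr1 val) /= /addIn /eqP.
by rewrite eqn_pmul2r // => /eqP /val_inj.
Qed.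

Lemma block_disjoint k l : k != l -> [disjoint block k & block l].
Proof.
move=> ne; rewrite -setI_eq0; apply/eqP/setP=> i; rewrite !inE.
by apply/andP=> -[/eqP-> /eqP /val_inj kl]; rewrite kl eqxx in ne.
Qed.

(** Pigeonhole on residues. The bound is [2 * s] so that [S] may be the union of two cores. *)
Lemma block_missed S : #|S| <= 2 * s -> exists k, [disjoint S & block k].
Proof.
move=> le_S; pose c (i : 'I_n) := inord (i %% (2 * s).+1) : 'I_(2 * s).+1.
have : ~~ ([set: 'I_(2 * s).+1] \subset c @: S).
  apply/negP=> /subset_leq_card; rewrite cardsT card_ord leqNgt.
  by rewrite ltnS (leq_trans (leq_imset_card _ _)).
case/subsetPn=> k _ kS; exists k; rewrite -setI_eq0.
apply/eqP/setP=> i; rewrite !inE; apply: contraNF kS => /andP[iS /eqP ik].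
apply/imsetP; exists i => //; apply: val_inj.
by rewrite /= inordK -?ik // ltn_mod.
Qed.

(* Since [2 * (r - s) > r], at most one block contains [r - s] points of the
   support; these are then set aside.  Other supports are of no use, and get an
   arbitrary [s]-subset. *)
Definition core v : {set 'I_n} :=
  if [pick k | #|supp v :&: block k| == r - s] is Some k
  then supp v :\: block k else [set x in take s (enum (supp v))].

Lemma core_sub v : core v \subset supp v.
Proof.
rewrite /core; case: pickP => [k _|_]; first exact: subsetDl.
by apply/subsetP=> x; rewrite inE => /mem_take; rewrite mem_enum.
Qed.

Lemma card_core v : #|core v| = s.
Proof.
rewrite /core; case: pickP => [k /eqP ck|_].
  have := cardsID (block k) (supp v); rewrite ck card_supp; lia.
rewrite cardsE (card_uniqP _) ?take_uniq ?enum_uniq //.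
by rewrite size_takel // -cardE card_supp; lia.
Qed.

Lemma core_block v S Y k :
    supp v = S :|: Y -> #|S| = s -> [disjoint S & block k] ->
    Y \subset block k -> core v = S.
Proof.
move=> vSY cS dS sY; have vk : supp v :\: block k = S.
  move: sY; rewrite -setD_eq0 vSY setDUl (setDidPl dS) => /eqP->.
  exact: setU0.
have ck : #|supp v :&: block k| = r - s.
  have := cardsID (block k) (supp v); rewrite vk cS card_supp; lia.
rewrite /core; case: pickP => [l /eqP cl|/(_ k)]; last by rewrite ck eqxx.
case: (eqVneq k l) => [<- //|/block_disjoint dkl].
(* A second block [l] with [r - s] points of the support would force [2 * (r - s) <= r], against
   [hrs]. *)
have : #|(supp v :&: block k) :|: (supp v :&: block l)| <= #|supp v|.
  by apply: subset_leq_card; rewrite -setIUr subsetIl.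
rewrite cardsU setIACA setIid (_ : block k :&: block l = set0); last first.
  by apply/eqP; rewrite setI_eq0.
by rewrite setI0 cards0 ck cl card_supp; lia.
Qed.

(** In a block missed by the core [S], distinct subsets [Y] of size [r - s] give distinct supports
    [S :|: Y], all with core [S]. *)
Lemma core_fiber_large v :
  'C(n %/ (2 * s).+1, r - s) <= #|[set w | core w == core v]|.
Proof.
set S := core v; have cS : #|S| = s by apply: card_core.
have [|k dS] := @block_missed S; first by rewrite cS; lia.
apply: leq_trans (leq_bin2l _ (card_block k)) _; rewrite -cards_draws.
set W := [set Y | _ & _].
have dY Y : Y \in W -> [disjoint S & Y].
  by rewrite inE => /andP[sY _]; apply: disjointWr sY dS.
have <- : #|[set S :|: Y | Y in W]| = #|W|.
  apply: card_in_imset => Y Z /dY dY1 /dY dZ1 /(congr1 (fun A => A :\: S)).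
  by rewrite !setDUl setDv !set0U !(setDidPl _) // disjoint_sym.
apply: leq_trans (leq_imset_card (@supp n r) _).
apply/subset_leq_card/subsetP=> _ /imsetP[Y YW ->].
have [|w sw] := @supp_surj n r (S :|: Y).
  rewrite cardsU (_ : S :&: Y = set0) ?cards0; last first.
    by apply/eqP; rewrite setI_eq0 dY.
  by move: YW; rewrite inE cS => /andP[_ /eqP->]; lia.
apply/imsetP; exists w; rewrite // inE; apply/eqP.
by apply: core_block sw cS dS _; move: YW; rewrite inE => /andP[].
Qed.

(** A non-neighbour [w] in the class of [v], possibly [v] itself, shares with [v] a point [z]
    outside the core. There are [r - s] choices for [z], and the remaining [r - s - 1] points of [w]
    outside the core are bounded by all subsets of that size. *)
Lemma core_fiber_deg v :
  #|[set w | (core w == core v) && ~~ johnson_edge s v w]|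
    <= (r - s) * 'C(n, (r - s).-1).
Proof.
set S := core v; have cS : #|S| = s by apply: card_core.
have sS : S \subset supp v by apply: core_sub.
rewrite -(card_imset _ (@supp_inj n r)).
pose P := [set Y : {set 'I_n} | #|Y| == (r - s).-1].
pose g (z : 'I_n) Y := (z |: S) :|: Y.
apply: leq_trans (_ : #|[set g z Y | z in supp v :\: S, Y in P]| <= _).
  apply/subset_leq_card/subsetP=> _ /imsetP[w + ->].
  rewrite inE => /andP[/eqP eqS nadj].
  have sSw : S \subset supp w by rewrite -eqS core_sub.
  have [z zw] : exists z, z \in (supp w :&: supp v) :\: S.
    apply/set0Pn; rewrite setD_eq0; apply: contra nadj => sub.
    have eSI : supp v :&: supp w = S.
      by apply/eqP; rewrite eqEsubset setIC sub subsetI sS sSw.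
    rewrite /johnson_edge inner_prod_supp eSI cS eqxx andbT.
    apply: contra_eq_neq eSI => <-; rewrite setIid.
    by apply: contraTneq hrs => eqv; rewrite -(card_supp v) eqv cS; lia.
  move: zw; rewrite in_setD in_setI => /and3P[zS zw zv].
  have sZ : z |: S \subset supp w by rewrite subUset sub1set zw.
  apply/imset2P; exists z (supp w :\: (z |: S)).
  - by rewrite in_setD zS zv.
  - rewrite inE; have := cardsID (z |: S) (supp w).
    by rewrite (setIidPr sZ) cardsU1 zS cS card_supp; lia.
  - by rewrite /g -[LHS](setID _ (z |: S)) (setIidPr sZ).
rewrite curry_imset2X; apply: leq_trans (leq_imset_card _ _) _.
rewrite cardsX card_draws card_ord leq_mul //.
have := cardsID S (supp v); rewrite (setIidPr sS) cS card_supp => cD.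
by rewrite leq_subRL ?cD //; lia.
Qed.

(** The cores are completed inside a block that both miss, by sets [P] and [P']. Since the cores
    already share [j] points, [P] and [P'] are made to share exactly [s - j]. *)
Lemma core_fiber_edge v w : 4 * r <= n %/ (2 * s).+1 ->
  exists a b, [/\ core a = core v, core b = core w, a != v, b != w
                & johnson_edge s a b].
Proof.
move=> large; set S := core v; set S' := core w.
have cS : #|S| = s by apply: card_core.
have cS' : #|S'| = s by apply: card_core.
have [|k dk] := @block_missed (S :|: S').
  by apply: leq_trans (leq_card_setU S S') _; rewrite cS cS'; lia.
have [dS dS'] : [disjoint S & block k] /\ [disjoint S' & block k].
  by split; apply: disjointWl dk; rewrite ?subsetUl ?subsetUr.
set j := #|S :&: S'|.
have le_j : j <= s by rewrite -cS subset_leq_card ?subsetIl.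
(* Staying off both supports makes [a] differ from [v] and [b] from [w]. At least [4 * r - 2 * r]
   points of the block remain, enough for [P] and a disjoint [Y]. *)
pose F := block k :\: (supp v :|: supp w).
have cF : 2 * r <= #|F|.
  have := cardsID (supp v :|: supp w) (block k).
  have := card_block k; have := (leq_card_setU (supp v) (supp w)).1.
  have := subset_leq_card (subsetIr (block k) (supp v :|: supp w)).
  rewrite !card_supp -/F; lia.
have [P sP cP] := @subset_of_card _ F (r - s) ltac:(lia).
have [X sX cX] := @subset_of_card _ P (s - j) ltac:(lia).
have [Y sY cY] := @subset_of_card _ (F :\: P) (r - s - (s - j))
  ltac:(have := cardsID P F; rewrite (setIidPr sP); lia).
have [sYF dYP] : Y \subset F /\ [disjoint Y & P].
  by apply/andP; rewrite -subsetD.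
have [lt_sr le_X] : s < r /\ s - j <= r - s by clear -hrs; lia.
pose P' := X :|: Y.
have sP' : P' \subset F by rewrite subUset sYF (subset_trans sX sP).
have PP' : P :&: P' = X.
  by rewrite setIUr (setIidPr sX) setIC (disjoint_setI0 dYP) setU0.
have cP' : #|P'| = r - s.
  rewrite cardsU (disjoint_setI0 (disjointWl sX _)) 1?disjoint_sym //.
  by rewrite cards0 subn0 cX cY subnKC.
clearbody P'.
have sFk : F \subset block k by apply: subsetDl.
have dF (A B : {set 'I_n}) :
    [disjoint A & block k] -> B \subset F -> A :&: B = set0.
  move=> dA sB; apply: disjoint_setI0; apply: disjointWr dA.
  exact: subset_trans sB sFk.
have cU (A B : {set 'I_n}) : [disjoint A & block k] -> B \subset F ->
    #|A| = s -> #|B| = r - s -> #|A :|: B| = r.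
  move=> dA sB cA cB.
  by rewrite cardsU (dF _ _ dA sB) cards0 subn0 cA cB subnKC // ltnW.
have [a sa] := supp_surj (cU _ _ dS sP cS cP).
have [b sb] := supp_surj (cU _ _ dS' sP' cS' cP').
have avoid (u u' : johnson_vertex n r) (A B : {set 'I_n}) :
    #|B| = r - s -> B \subset F -> supp u' = A :|: B ->
    supp u \subset supp v :|: supp w -> u' != u.
  move=> cB sB su' su; have /card_gt0P[x xB] : 0 < #|B| by rewrite cB subn_gt0.
  have := subsetP sB x xB; rewrite 2!inE => /andP[xvw _].
  apply: contraNneq xvw => eq_u; have := subsetP su x.
  by rewrite -eq_u su' inE xB orbT inE; apply.
exists a, b; split.
- by apply: core_block sa cS dS _; apply: subset_trans sP sFk.
- by apply: core_block sb cS' dS' _; apply: subset_trans sP' sFk.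
- by apply: avoid cP sP sa _; apply: subsetUl.
- by apply: avoid cP' sP' sb _; apply: subsetUr.
(* The intersection is [S :&: S'] together with [X]; the mixed terms vanish because both cores miss
   the block. *)
have cab : #|supp a :&: supp b| = s.
  rewrite sa sb setIUl !setIUr PP' (dF _ _ dS sP') [P :&: S']setIC.
  rewrite (dF _ _ dS' sP) setU0 set0U cardsU cX -/j subnKC //.
  rewrite (_ : S :&: S' :&: X = set0) ?cards0 ?subn0 //.
  by rewrite -setIA [S' :&: X](dF _ _ dS') ?setI0 ?(subset_trans sX).
rewrite /johnson_edge inner_prod_supp cab eqxx andbT.
by apply: contra_eq_neq cab => <-; rewrite setIid card_supp gtn_eqF.
Qed.

End Blocks.

Theorem theorem3p21 (r s : nat) (hrs : 2 * s + 1 <= r) :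
  exists N : nat, forall n : nat, N < n -> hamiltonian (@johnson_edge n r s).
Proof.
have [N bin_large] := @bin_block_dominates (2 * s).+1 (r - s).-1 isT.
have eq_q : (r - s).-1.+1 = r - s by lia.
(* The first bound makes the classes large compared with their non-degrees; the second leaves room
   in the blocks for edges between classes, and yields [r <= n], so that vertices exist. *)
exists (maxn N (4 * r * (2 * s).+1)) => n; rewrite gtn_max => /andP[ltN lt_n].
have large : 4 * r <= n %/ (2 * s).+1 by rewrite leq_divRL // ltnW.
apply: (@hamiltonian_fibers _ _ _ (@core n r s)
          ((r - s) * 'C(n, (r - s).-1))).
- exact: johnson_edge_sym.
- exact: johnson_edge_irr.
- exact: core_fiber_deg.
- move=> v; apply: leq_trans (core_fiber_large hrs v).
  by have := bin_large n ltN; rewrite eq_q.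
- by move=> v w; apply: core_fiber_edge.
have [|A _ cA] := @subset_of_card _ [set: 'I_n] r.
  rewrite cardsT card_ord; move: lt_n; nia.
by have [v _] := supp_surj cA; apply/card_gt0P; exists v.
Qed.
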